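(* For every $L>0$ there exist a convex $L$-smooth function $f:\mathbb{R}\to\mathbb{R}$ and a point $x_0\in\mathbb{R}$ such that for every step size $\eta\in\left(\frac{1.75}{L},\frac{2}{L}\right)$, the gradient descent iterates $\{x_k\}_{k=0}^{\infty}$ started at $x_0$ and defined by $x_k=x_{k-1}-\eta f'(x_{k-1})$ for all $k\ge 1$ are such that the mapping $k\mapsto f(x_k)$ is not convex over $\mathbb{Z}_{\ge 0}$.
   Context: A function $f:\mathbb{R}\to\mathbb{R}$ is $L$-smooth if it is differentiable and its derivative is $L$-Lipschitz: $|f'(x)-f'(y)|\le L|x-y|$ for all $x,y\in\mathbb{R}$. For a real sequence $\{a_k\}_{k=0}^{\infty}$, the mapping $k\mapsto a_k$ is said to be convex over $\mathbb{Z}_{\ge 0}$ if the function $g:[0,\infty)\to\mathbb{R}$ defined by $g(t)=a_{\lfloor t\rfloor}+(t-\lfloor t\rfloor)(a_{\lfloor t\rfloor+1}-a_{\lfloor t\rfloor})$ (the linear interpolation of the points $(k,a_k)$) is convex. This is equivalent to the sequence $\{a_k-a_{k+1}\}_{k=0}^{\infty}$ being non-increasing. *)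

(* Defs.v *)
From HB Require Import structures.
From mathcomp Require Import all_boot all_order all_algebra.
From mathcomp Require Import all_classical all_reals all_analysis.

Set Implicit Arguments.
Unset Strict Implicit.
Unset Printing Implicit Defensive.

Import Order.TTheory GRing.Theory Num.Theory.
Import numFieldNormedType.Exports.

Local Open Scope classical_set_scope.
Local Open Scope ring_scope.

Definition smooth (R : realType) (L : R) (f : R -> R) : Prop :=
  (forall x : R, derivable f x 1) /\ L.-lipschitz (derive1 f).

Definition gd_iterate (R : realType) (f : R -> R) (eta x0 : R) (k : nat) : R :=
  iter k (fun x => x - eta * derive1 f x) x0.

(* Linear interpolation of the points (k, a k). On [0, +oo[, [Num.truncn] is
   the floor; the values of this function at negative t are never used. *)
Definition interpolation (R : realType) (a : nat -> R) (t : R) : R :=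
  let k := Num.truncn t in a k + (t - k%:R) * (a k.+1 - a k).

Definition convex_seq (R : realType) (a : nat -> R) : Prop :=
  convex_function (`[0, +oo[%classic : set R) (interpolation a).

(* Main.v *)
Require Import Defs.
From HB Require Import structures.
From mathcomp Require Import all_boot all_order all_algebra.
From mathcomp Require Import all_classical all_reals all_analysis.
From mathcomp Require Import ring lra.

Import Order.TTheory GRing.Theory Num.Theory.
Import numFieldNormedType.Exports.

Local Open Scope classical_set_scope.
Local Open Scope convex_scope.
Local Open Scope ring_scope.

(** Take L = 1 (the general case multiplies f by L and divides eta by L). The
    function f is x^2/2 on [-5/9, +oo[, continued by its tangent line on the
    left, so that f'(x) = max(x, -5/9). From x_0 = 1 the first step lands at
    x_1 = 1 - eta, on the linear part, and the second one at
    x_2 = 1 - 4 eta / 9, on the quadratic part. The second difference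
    f(x_0) - 2 f(x_1) + f(x_2) is then a convex quadratic polynomial in eta
    which vanishes at eta = 7/4 and is negative at eta = 2. *)

(** The difference quotient at step [h] is within [C * |h|] of [g]. This settles the kink of [huber]
    with no one-sided limits. *)
Lemma is_derive_quadratic_remainder (R : realType) (f : R -> R) (C g x : R) :
  (forall y, `|f y - f x - g * (y - x)| <= C * (y - x) ^+ 2) ->
  is_derive x 1 f g.
Proof.
move=> fC.
have C_ge0 : 0 <= C.
  have := le_trans (normr_ge0 _) (fC (x + 1)).
  by rewrite addrAC subrr add0r expr1n mulr1.
have quotient_cvg : h^-1 *: (f (h *: 1 + x) - f x) @[h --> 0^'] --> g.
  apply/cvgrPdist_le => e e0; near=> h.
  have h0 : h != 0 by near: h; exact: nbhs_dnbhs_neq.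
  have -> : g - h^-1 *: (f (h *: 1 + x) - f x) =
            - (h^-1 * (f (h + x) - f x - g * h)).
    by rewrite /GRing.scale /= mulr1; field.
  rewrite normrN normrM normfV ler_pdivrMl ?normr_gt0//.
  have := fC (h + x); rewrite addrK => /le_trans; apply.
  rewrite -real_normK ?num_real// expr2 mulrCA ler_wpM2l//.
  (* [C] may be 0, whereas [C + 1] can be divided by. *)
  rewrite (@le_trans _ _ ((C + 1) * `|h|))// ?ler_wpM2r ?lerDl//.
  rewrite -ler_pdivlMl ?ltr_wpDl//.
  near: h; apply: dnbhs0_le.
  by rewrite mulr_gt0 ?invr_gt0 ?ltr_wpDl.
apply: DeriveDef; first by apply/cvg_ex; exists g.
exact: cvg_lim quotient_cvg.
Unshelve. all: end_near.
Qed.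

(** Average the supporting line at [z = s x + (1 - s) y], taken at [x] and at [y]: the slope terms
    cancel. *)
Lemma convex_function_subgradient (R : realType) (f g : R -> R) :
  (forall x y, f x + g x * (y - x) <= f y) ->
  convex_function ([set: R] : set R) f.
Proof.
move=> fg t x y _ _; rewrite !convRE /unstable.onem.
have -> : (x : convex_lmodType R^o) <| t |> y
          = t%:num * (x : R) + (1 - t%:num) * (y : R) by [].
set s := t%:num; set z := s * _ + _ in |- * => /=.
have s0 : 0 <= s by rewrite /s.
have s1 : 0 <= 1 - s by rewrite subr_ge0 /s.
have lex := ler_wpM2l s0 (fg z x).
have ley := ler_wpM2l s1 (fg z y).
apply: le_trans (lerD lex ley).
by rewrite le_eqVlt; apply/orP; left; apply/eqP; rewrite /z; ring.
Qed.

Lemma interpolation_nat (R : realType) (a : nat -> R) (k : nat) :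
  interpolation a k%:R = a k.
Proof. by rewrite /interpolation natrK subrr mul0r addr0. Qed.

(** [k.+1] is the midpoint of [k] and [k.+2]. *)
Lemma convex_seq_second_difference (R : realType) (a : nat -> R) (k : nat) :
  convex_seq a -> 2 * a k.+1 <= a k + a k.+2.
Proof.
have half01 : Itv.spec (@Itv.num_sem R) (Itv.Real `[0%Z, 1%Z]) (2^-1 : R).
  by rewrite /= /Itv.num_sem /= num_real in_itv /=; apply/andP; split; lra.
pose t : {i01 R} := Itv.mk half01.
have nat_in (n : nat) : (n%:R : R) \in (`[0, +oo[%classic : set R).
  by rewrite inE /= in_itv /= ler0n.
move=> /(_ t _ _ (nat_in k) (nat_in k.+2)); rewrite !convRE /=.
have -> : (k%:R : convex_lmodType R^o) <| t |> k.+2%:R = k.+1%:R.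
  transitivity (2^-1 * k%:R + (1 - 2^-1) * k.+2%:R : R) => //.
  by rewrite -[k.+2]addn2 -[k.+1]addn1 !natrD; lra.
rewrite !interpolation_nat /unstable.onem; lra.
Qed.

(** With the kink at [-d], the second difference at [eta = 7/4] is [81/32 (d - 5/9)^2], which
    vanishes only for [d = 5/9]. *)
Definition huber {R : realType} (x : R) : R :=
  if - (5 / 9) <= x then x ^+ 2 / 2 else - (5 / 9) * x - 25 / 162.

Definition huber_grad {R : realType} (x : R) : R := Num.max x (- (5 / 9)).

(** The lower bound yields convexity; together the two bounds yield the derivative. *)
Lemma huber_remainder {R : realType} (x y : R) :
  0 <= huber y - huber x - huber_grad x * (y - x) <= (y - x) ^+ 2 / 2.
Proof.
rewrite /huber /huber_grad maxEge; have sq_ge0 := sqr_ge0 (y - x).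
by case: (lerP (- (5 / 9)) x) => hx; case: (lerP (- (5 / 9)) y) => hy;
   apply/andP; split; nra.
Qed.

Lemma huber_grad_lipschitz {R : realType} (x y : R) :
  `|huber_grad x - huber_grad y| <= `|x - y|.
Proof.
rewrite /huber_grad !maxEge; wlog xy : x y / y <= x => [hw|].
  by case: (leP y x) => [/hw//|/ltW/hw]; rewrite distrC (distrC x).
rewrite (ger0_norm (_ : 0 <= x - y)) ?subr_ge0//.
by case: (lerP (- (5 / 9)) x) => hx; case: (lerP (- (5 / 9)) y) => hy;
   rewrite ger0_norm; lra.
Qed.

Lemma derive_scaled_huber {R : realType} (L x : R) : 0 < L ->
  is_derive x 1 (fun y => L * huber y) (L * huber_grad x).
Proof.
move=> L0; apply: (@is_derive_quadratic_remainder _ _ (L / 2)) => y.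
have /andP[lo hi] := huber_remainder x y.
rewrite -mulrBr -mulrA -mulrBr ger0_norm ?(mulr_ge0 (ltW L0))//.
by rewrite mulrAC -mulrA ler_pM2l.
Qed.

Lemma derive1_scaled_huber {R : realType} (L : R) : 0 < L ->
  derive1 (fun x => L * huber x) = (fun x => L * huber_grad x).
Proof.
move=> L0; apply/funext => x; rewrite derive1E.
exact: (@derive_val _ _ _ _ _ _ _ (derive_scaled_huber L x L0)).
Qed.

Theorem theorem2 (R : realType) (L : R) (hL : 0 < L) :
  exists (f : R -> R) (x0 : R),
    [/\ convex_function ([set: R] : set R) f,
        smooth L f
      & forall eta : R, 7 / 4 / L < eta < 2 / L ->
          ~ convex_seq (fun k : nat => f (gd_iterate f eta x0 k))].
Proof.
exists (fun x => L * huber x), 1; split.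
- apply: (@convex_function_subgradient _ _ (fun x => L * huber_grad x)) => x y.
  have /andP[+ _] := huber_remainder x y.
  by rewrite -mulrA -mulrDr ler_pM2l// subr_ge0 lerBrDl.
- split=> [x|].
    exact: (@ex_derive _ _ _ _ _ _ _ (derive_scaled_huber L x hL)).
  rewrite derive1_scaled_huber// => -[x y] _ /=.
  by rewrite -mulrBr normrM gtr0_norm// ler_pM2l// huber_grad_lipschitz.
- move=> eta /andP[]; rewrite ltr_pdivrMr// ltr_pdivlMr// => lo hi.
  move=> /(@convex_seq_second_difference _ _ 0).
  rewrite /gd_iterate /= derive1_scaled_huber// !mulrA.
  (* The iterates depend on [eta] and [L] only through [s], which lies in []7/4, 2[]. *)
  set s := eta * L in lo hi *.
  have -> : huber_grad (1 : R) = 1.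
    by rewrite /huber_grad maxEge ifT//; lra.
  have -> : huber_grad (1 - s * 1) = - (5 / 9).
    by rewrite /huber_grad maxEge ifF//; apply/negbTE; rewrite -ltNge; lra.
  rewrite mulr1 (mulrC 2 L) -(mulrA L 2) -mulrDr ler_pM2l//.
  rewrite /huber ifF; last by apply/negbTE; rewrite -ltNge; lra.
  rewrite ifT; last lra.
  rewrite ifT; last lra.
  (* The inequality now reads [0 <= 2 (4 s - 7) (s - 14) / 81], which is false for [7/4 < s < 2]. *)
  nra.
Qed.
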